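(* Let $n\ge 11$. Then there exists a $4$-uniform hypergraph $\mathcal{H}=(V,\mathcal{E})$ with $EI(\mathcal{H})=C_n$ and $|\mathcal{E}|=n$.
   Context: Hypergraphs $\mathcal{H}=(V,\mathcal{E})$ have no multiple hyperedges; isolated vertices are allowed. $\mathcal{H}$ is $4$-uniform if every hyperedge has exactly $4$ elements. The edge intersection hypergraph of $\mathcal{H}$ is $EI(\mathcal{H})=(V,\mathcal{E}^{EI})$ with $\mathcal{E}^{EI}=\{e_1\cap e_2: e_1,e_2\in\mathcal{E},\ e_1\ne e_2,\ |e_1\cap e_2|\ge 2\}$. $C_n$ is the cycle with vertex set $\{1,\dots,n\}$ and edges $\{i,i+1\}$, $i=1,\dots,n$ (indices mod $n$); ''$EI(\mathcal{H})=C_n$'' means $V=\{1,\dots,n\}$ and $\mathcal{E}^{EI}$ is exactly the edge set of $C_n$. *)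

(* Defs.v *)
From mathcomp Require Import all_boot.

Set Implicit Arguments.
Unset Strict Implicit.
Unset Printing Implicit Defensive.

(* A hypergraph (V, E) with finite vertex set V is given by a finType V and its
   set of hyperedges E; isolated vertices are allowed, multiple hyperedges are
   not. *)
Definition hypergraph (V : finType) := {set {set V}}.

Definition uniform (V : finType) (k : nat) (E : hypergraph V) : Prop :=
  forall e : {set V}, e \in E -> #|e| = k.

Definition edge_intersection (V : finType) (E : hypergraph V) : hypergraph V :=
  [set e1 :&: e2 | e1 in E, e2 in E & (e1 != e2) && (2 <= #|e1 :&: e2|)].

(* The ordinal i stands for the vertex i + 1 of {1, ..., n}; ordS i is the
   successor of i modulo n. *)
Definition cycle_graph (n : nat) : hypergraph 'I_n :=
  [set [set i; ordS i] | i : 'I_n].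

(* Main.v *)
(** Take the n translates of B = {0, 1, 2, 5} modulo n.  A difference of two
    elements of B has absolute value at most 5, so for n >= 11 an equality of
    two such differences modulo n holds in the integers.  The only nonzero
    differences attained more than once in B are 1 = 1 - 0 = 2 - 1 and -1; hence
    two distinct translates share two points only if they are consecutive, and
    then i + B and (i + 1) + B meet exactly in the edge {i + 1, i + 2}. *)
Require Import Defs.
From mathcomp Require Import all_boot zmodp.

(** Writing n as [m.+1] keeps the vertex type nonempty, as [inZp] requires; the bound n >= 11 then
    reads [10 <= m]. *)
Definition shift (m : nat) (i : 'I_m.+1) (d : nat) : 'I_m.+1 := inZp (i + d).

Definition base : seq nat := [:: 0; 1; 2; 5].

Definition block (m : nat) (i : 'I_m.+1) : {set 'I_m.+1} :=
  [set:: [seq shift m i d | d <- base]].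

Lemma shiftD (m : nat) (i : 'I_m.+1) (a b : nat) :
  shift m (shift m i a) b = shift m i (a + b).
Proof. by apply: val_inj; rewrite /= modnDml addnA. Qed.

Lemma ordS_shift (m : nat) (i : 'I_m.+1) : ordS i = shift m i 1.
Proof. by apply: val_inj; rewrite /= addn1. Qed.

Lemma shift_injl (m d : nat) : injective (fun i : 'I_m.+1 => shift m i d).
Proof.
move=> i j /(congr1 val) /= /eqP; rewrite eqn_modDr !modn_small //.
by move/eqP/val_inj.
Qed.

Lemma shift_injr (m : nat) (i : 'I_m.+1) (a b : nat) :
  a <= m -> b <= m -> shift m i a = shift m i b -> a = b.
Proof.
move=> am bm /(congr1 val) /= /eqP; rewrite eqn_modDl !modn_small //.
by move/eqP.
Qed.

(** Adding the two congruences crosswise lets i + k cancel; the size bounds turn the remaining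
    congruence modulo [m.+1] into an equality. *)
Lemma shift_cross (m : nat) (i k : 'I_m.+1) (a b a' b' : nat) :
    a + b' <= m -> a' + b <= m ->
    shift m i a = shift m k b -> shift m i a' = shift m k b' ->
  a + b' = a' + b.
Proof.
move=> ab ab' /(congr1 val) /= e /(congr1 val) /= e'.
have : (i + a) + (k + b') = (i + a') + (k + b) %[mod m.+1].
  by rewrite -modnDm e -e' modnDm addnC.
rewrite (addnACA i a) (addnACA i a') => /eqP; rewrite eqn_modDl !modn_small //.
by move/eqP.
Qed.

Lemma base_le5 (a : nat) : a \in base -> a <= 5.
Proof. by rewrite !inE => /or4P[] /eqP->. Qed.

(** Checked case by case. The equality a - b = a' - b' is stated with sums because subtraction on
    [nat] truncates. *)
Lemma base_differences (a b a' b' : nat) :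
    a \in base -> b \in base -> a' \in base -> b' \in base ->
    a + b' = a' + b -> a != a' -> a != b ->
  a = b.+1 \/ b = a.+1.
Proof.
rewrite !inE => /or4P[] /eqP-> /or4P[] /eqP-> /or4P[] /eqP-> /or4P[] /eqP-> //;
  by [left | right].
Qed.

Lemma mem_blockP (m : nat) (i x : 'I_m.+1) :
  reflect (exists2 d, d \in base & x = shift m i d) (x \in block m i).
Proof. by rewrite inE; apply: mapP. Qed.

Lemma mem_block (m : nat) (i : 'I_m.+1) (d : nat) :
  d \in base -> shift m i d \in block m i.
Proof. by move=> db; apply/mem_blockP; exists d. Qed.

Lemma card_block (m : nat) (i : 'I_m.+1) : 10 <= m -> #|block m i| = 4.
Proof.
move=> hm; rewrite cardsE; apply/card_uniqP; rewrite map_inj_in_uniq // => a b.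
have le5m : 5 <= m by apply: leq_trans hm.
by move=> /base_le5 a5 /base_le5 b5; apply: shift_injr; apply: leq_trans le5m.
Qed.

Lemma block_meet_next (m : nat) (i : 'I_m.+1) : 10 <= m ->
  block m i :&: block m (shift m i 1) = [set shift m i 1; shift m i 2].
Proof.
move=> hm; apply/eqP; rewrite eqEsubset; apply/andP; split; apply/subsetP => x.
  case/setIP => /mem_blockP[a ab ->] /mem_blockP[b bb]; rewrite shiftD.
  (* Seen from i, the second block has offsets up to 1 + 5 = 6. *)
  have le6m : 6 <= m by apply: leq_trans hm.
  have am : a <= m := leq_trans (base_le5 _ ab) (ltnW le6m).
  have bm : 1 + b <= m := leq_trans (leq_add (leqnn 1) (base_le5 _ bb)) le6m.
  (* Now a = b + 1 with both in [base]: b = 2 and b = 5 would give 3 and 6, so only a = 1 and a = 2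
     survive. *)
  move/(shift_injr m i _ _ am bm) => e; move: bb ab; rewrite e !inE.
  by case/or4P => /eqP-> // _; rewrite ?addn0 eqxx ?orbT.
case/set2P => ->; rewrite inE mem_block //=.
  by apply/mem_blockP; exists 0; rewrite // shiftD.
by apply/mem_blockP; exists 1; rewrite // shiftD.
Qed.

Lemma block_meet_consecutive (m : nat) (i k : 'I_m.+1) :
    10 <= m -> i != k -> 2 <= #|block m i :&: block m k| ->
  k = shift m i 1 \/ i = shift m k 1.
Proof.
move=> hm ik /card_gt1P[x [y [/setIP[xi xk] /setIP[yi yk] xy]]].
case/mem_blockP: xi => a ab xa; case/mem_blockP: xk => b bb xb.
case/mem_blockP: yi => a' ab' ya; case/mem_blockP: yk => b' bb' yb.
(* Sums of two offsets reach 5 + 5 = 10; here the bound on m is used in full. *)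
have le10 c d : c \in base -> d \in base -> c + d <= m.
  by move=> /base_le5 c5 /base_le5 d5; apply: leq_trans (leq_add c5 d5) hm.
have eab : shift m i a = shift m k b by rewrite -xa.
have eab' : shift m i a' = shift m k b' by rewrite -ya.
have dif := shift_cross m i k a b a' b' (le10 _ _ ab bb') (le10 _ _ ab' bb) eab eab'.
have naa : a != a' by apply: contraNneq xy => e; rewrite xa ya e.
have nab : a != b by apply: contraNneq ik => e; apply/eqP/(shift_injl m a); rewrite eab e.
case: (base_differences a b a' b' ab bb ab' bb' dif naa nab) => e.
  by left; apply: (shift_injl m b); rewrite /= shiftD add1n -e eab.
by right; apply: (shift_injl m a); rewrite /= shiftD add1n -e eab.
Qed.

Lemma card_shift12 (m : nat) (i : 'I_m.+1) : 10 <= m ->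
  #|[set shift m i 1; shift m i 2]| = 2.
Proof.
move=> hm; have [m1 m2] : 1 <= m /\ 2 <= m by split; apply: leq_trans hm.
by rewrite cards2; case: eqP => // /(shift_injr m i _ _ m1 m2).
Qed.

(** Equal blocks with distinct indices would meet in 4 vertices, so their indices would be
    consecutive and the meet would have only 2. *)
Lemma block_inj (m : nat) : 10 <= m -> injective (block m).
Proof.
move=> hm i k e; apply/eqP/contraT => ik.
have card4 : #|block m i :&: block m k| = 4 by rewrite e setIid card_block.
have [|ek|ei] := block_meet_consecutive m i k hm ik; first by rewrite card4.
  by move: card4; rewrite ek block_meet_next // card_shift12.
by move: card4; rewrite setIC ei block_meet_next // card_shift12.
Qed.

Lemma edge_intersection_blocks (m : nat) : 10 <= m ->
  edge_intersection [set block m i | i : 'I_m.+1] = cycle_graph m.+1.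
Proof.
move=> hm.
have edge_shift i : [set shift m i 1; shift m i 2] \in cycle_graph m.+1.
  by apply/imsetP; exists (shift m i 1); rewrite // ordS_shift shiftD.
apply/setP => s; apply/idP/idP.
  case/imset2P => e1 e2 /imsetP[i _ ->]; rewrite inE.
  case/andP => /imsetP[k _ ->] /andP[nik c2] ->.
  have ik : i != k by apply: contraNneq nik => ->.
  case: (block_meet_consecutive m i k hm ik c2) => ->.
    by rewrite block_meet_next.
  by rewrite setIC block_meet_next.
case/imsetP => j _ ->.
(* Every vertex is a successor, so each cycle edge is the meet of two consecutive blocks. *)
have {j} [i ->] : exists i, j = shift m i 1.
  by exists (ord_pred j); rewrite -ordS_shift ord_predK.
rewrite ordS_shift shiftD -block_meet_next //.
apply/imset2P; exists (block m i) (block m (shift m i 1)) => //.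
  exact: imset_f.
rewrite inE imset_f //= block_meet_next // card_shift12 // andbT.
(* Were the two blocks equal, their meet would have 4 vertices instead of 2. *)
apply/eqP => /(congr1 (fun e => #|block m i :&: e|)).
by rewrite setIid block_meet_next // card_shift12 // card_block.
Qed.

Theorem theorem5 (n : nat) (hn : 11 <= n) :
  exists E : hypergraph 'I_n,
    [/\ uniform 4 E, edge_intersection E = cycle_graph n & #|E| = n].
Proof.
case: n hn => // m hm; exists [set block m i | i : 'I_m.+1]; split.
- by move=> e /imsetP[i _ ->]; apply: card_block.
- exact: edge_intersection_blocks.
- by rewrite card_imset ?card_ord //; apply: block_inj.
Qed.
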